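(* For (Lebesgue) almost every $x\in[0,1]$ the Lyapunov exponent satisfies $\Lambda(x)=0$. In particular, for almost every $x$ the $\limsup$ in the definition $\Lambda(x)=\limsup_{n\to\infty}\frac{\ln w_n(x)}{n}$ can be replaced by the usual limit.
   Context: Let $L=\begin{pmatrix}1&1\\0&1\end{pmatrix}$, $R=\begin{pmatrix}1&0\\1&1\end{pmatrix}$. Path on the Farey tree. For real $x\ge 0$ define matrices $A_n(x)=\begin{pmatrix}a_n&b_n\\c_n&d_n\end{pmatrix}$ by $A_0(x)=I$ and $A_{n+1}(x)=A_n(x)R$ if $x<\frac{a_n+b_n}{c_n+d_n}$, $A_{n+1}(x)=A_n(x)L$ if $x>\frac{a_n+b_n}{c_n+d_n}$. If equality $x=\frac{a_n+b_n}{c_n+d_n}$ occurs (this happens only for positive rational $x$), the path is continued by the turns $L,R,R,R,\dots$ or by the turns $R,L,L,L,\dots$; either choice may be used. Lyapunov function. $w_n(x)$ is the largest entry of $A_n(x)$ (for $x\in[0,1)$, $n\ge1$, it is $\max(c_n,d_n)$), and $\Lambda(x)=\limsup_{n\to\infty}\frac{\ln w_n(x)}{n}$. *)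

(* Defs.v *)
From HB Require Import structures.
From mathcomp Require Import all_boot all_order all_algebra.
From mathcomp Require Import all_classical all_reals all_analysis.

Set Implicit Arguments.
Unset Strict Implicit.
Unset Printing Implicit Defensive.

Import Order.TTheory GRing.Theory Num.Theory.
Import numFieldNormedType.Exports.

Local Open Scope ring_scope.

Inductive turn := TurnL | TurnR.

Definition opposite_turn (t : turn) : turn :=
  match t with TurnL => TurnR | TurnR => TurnL end.

(* L = (1 1 ; 0 1) and R = (1 0 ; 1 1); all the matrices of a path have
   entries in nat, on which the product is the usual one. *)
Definition turn_mx (t : turn) : 'M[nat]_2 :=
  match t with
  | TurnL => \matrix_(i, j) nat_of_bool (i <= j)%N
  | TurnR => \matrix_(i, j) nat_of_bool (j <= i)%N
  end.

(* (a + b) / (c + d) for A = (a b ; c d). *)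
Definition mediant (R : realType) (A : 'M[nat]_2) : R :=
  (A ord0 ord0 + A ord0 ord_max)%N%:R / (A ord_max ord0 + A ord_max ord_max)%N%:R.

(* The second component of a state is [None] as long as x has not been equal to
   a mediant, and [Some t] afterwards, [t] being the turn that is then repeated
   forever. The parameter [e] is the turn made when equality occurs: the path is
   continued by L, R, R, ... if [e] is [TurnL] and by R, L, L, ... if [e] is
   [TurnR]. *)
Definition farey_step (R : realType) (e : turn) (x : R)
    (s : 'M[nat]_2 * option turn) : 'M[nat]_2 * option turn :=
  let: (A, o) := s in
  match o with
  | Some t => (A *m turn_mx t, Some t)
  | None =>
      if x < mediant R A then (A *m turn_mx TurnR, None)
      else if mediant R A < x then (A *m turn_mx TurnL, None)
      else (A *m turn_mx e, Some (opposite_turn e))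
  end.

Definition farey_path (R : realType) (e : turn) (x : R) (n : nat) : 'M[nat]_2 :=
  (iter n (farey_step e x) (1%:M, None)).1.

Definition largest_entry (A : 'M[nat]_2) : nat :=
  (\max_(i < 2) \max_(j < 2) A i j)%N.

(* The value at n = 0, where the denominator vanishes, is irrelevant. *)
Definition lyapunov_seq (R : realType) (e : turn) (x : R) (n : nat) : R :=
  ln (largest_entry (farey_path e x n))%:R / n%:R.

Definition Lyapunov (R : realType) (e : turn) (x : R) : \bar R :=
  limn_esup (EFin \o lyapunov_seq e x).

(* Main.v *)
Require Import Defs.
From HB Require Import structures.
From mathcomp Require Import all_boot all_order all_algebra.
From mathcomp Require Import all_classical all_reals all_analysis.
From mathcomp Require Import ring lra zify.

Import Order.TTheory GRing.Theory Num.Theory.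
Import numFieldNormedType.Exports.

Local Open Scope classical_set_scope.
Local Open Scope ring_scope.

(* The points whose path reaches A = (a b ; c d) form an interval of length
   1/(cd), so for uniform x the bottom row (c, d) is a Markov chain: with
   M = max(c, d), m = min(c, d) and v = M/m, the path keeps turning in the same
   direction with probability v/(v+1) (and v becomes v+1), and changes direction
   with probability 1/(v+1) (and v becomes 1+1/v). The mean run length is
   infinite, hence direction changes have zero density. Quantitatively, a bounded
   potential whose mean increment is at least P(change) - 2 delta turns
   (M + B m)^s, which grows by at most (1+1/B)^s along a run and (1+B)^s at a
   change, into a weight whose mean grows by at most exp(s eps) per step. So
   P(w_n > exp(2 eps n)) decays geometrically in n, and Borel-Cantelli concludes. *)

(** * A bounded potential of the ratio of the bottom-row entries *)

Definition cutoff {R : realType} (delta : R) : R := expR (2 / delta - 1).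

(* The cutoff is the maximum point of v * (2 - delta * ln v). *)
Definition potential {R : realType} (delta v : R) : R :=
  if v <= cutoff delta then v * (2 - delta * ln v) else delta * cutoff delta.

Lemma cutoff_gt0 (R : realType) (delta : R) : 0 < cutoff delta.
Proof. exact: expR_gt0. Qed.

Lemma ln_cutoff (R : realType) (delta : R) :
  0 < delta -> delta * ln (cutoff delta) = 2 - delta.
Proof. by move=> d0; rewrite expRK mulrBr mulr1 mulrCA divff ?mulr1// gt_eqF. Qed.

(** This is ln u <= u - 1 at u = [cutoff delta / v]: the concave function on the left has its
    maximum [delta * cutoff delta] at the cutoff. *)
Lemma potential_tangent (R : realType) (delta v : R) :
  0 < delta -> 0 < v -> v * (2 - delta * ln v) <= delta * cutoff delta.
Proof.
move=> d0 v0; have T0 := @cutoff_gt0 R delta.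
have : ln (cutoff delta / v) <= cutoff delta / v - 1.
  have := @le_ln1Dx R (cutoff delta / v - 1).
  rewrite (addrC 1) subrK; apply.
  by rewrite -subr_gt0 opprK subrK divr_gt0.
rewrite ln_div ?posrE// => h.
have -> : 2 - delta * ln v = delta * (1 + (ln (cutoff delta) - ln v)).
  by rewrite mulrDr mulrBr ln_cutoff//; ring.
rewrite mulrCA ler_pM2l// -ler_pdivlMl//.
by rewrite mulrC; lra.
Qed.

Lemma potential_ge (R : realType) (delta v : R) :
  0 < delta -> 0 < v -> v * (2 - delta * ln v) <= potential delta v.
Proof. by move=> d0 v0; rewrite /potential; case: ifP => // _; exact: potential_tangent. Qed.

Lemma potential_le (R : realType) (delta v : R) :
  0 < delta -> 0 < v -> potential delta v <= delta * cutoff delta.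
Proof. by move=> d0 v0; rewrite /potential; case: ifP => // _; exact: potential_tangent. Qed.

Lemma potential_ge0 (R : realType) (delta v : R) :
  0 < delta -> 0 < v -> 0 <= potential delta v.
Proof.
move=> d0 v0; have T0 := @cutoff_gt0 R delta.
rewrite /potential; case: ifP => [vT|_]; last by rewrite mulr_ge0// ltW.
rewrite mulr_ge0 ?(ltW v0)// subr_ge0.
have : ln v <= ln (cutoff delta) by rewrite ler_ln ?posrE.
by move=> /(ler_wpM2l (ltW d0)); rewrite ln_cutoff//; lra.
Qed.

(* Multiplied by v + 1: the mean increment of the potential from v is at least
   1 / (v + 1) - 2 * delta. *)
Lemma potential_drift (R : realType) (delta v : R) :
  0 < delta -> delta <= 1 -> 1 <= v ->
  (v + 1) * potential delta v + 1 - 2 * delta * (v + 1) <=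
  v * potential delta (v + 1) + potential delta (1 + v^-1).
Proof.
move=> d0 d1 v1; have v0 : 0 < v by lra.
have T0 := @cutoff_gt0 R delta.
have w0 : 0 < v^-1 by rewrite invr_gt0.
have w1 : v^-1 <= 1 by rewrite invf_le1.
have vw : v * v^-1 = 1 by rewrite divff// gt_eqF.
have [vT|Tv] := leP v (cutoff delta); last first.
  have -> : potential delta v = delta * cutoff delta.
    by rewrite /potential leNgt Tv.
  have -> : potential delta (v + 1) = delta * cutoff delta.
    by rewrite /potential leNgt (lt_trans Tv)//; lra.
  have p0 : 0 <= potential delta (1 + v^-1) by apply: potential_ge0 => //; lra.
  (* Beyond the cutoff a run keeps the potential at its maximum and a change may lose all of it. As
     [delta * v] is at least this maximum, itself at least 2, the allowance [2 * delta * (v + 1)]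
     covers the loss and the added 1. *)
  have Td : 2 <= delta * cutoff delta.
    have := @expR_ge1Dx R (2 / delta - 1).
    rewrite -/(cutoff delta) (addrC 1) subrK => /(ler_wpM2l (ltW d0)).
    by rewrite mulrCA divff ?mulr1// gt_eqF.
  have : delta * cutoff delta <= delta * v by rewrite ler_pM2l// ltW.
  nra.
have -> : potential delta v = v * (2 - delta * ln v) by rewrite /potential vT.
have h1 : (v + 1) * (2 - delta * ln (v + 1)) <= potential delta (v + 1).
  by apply: potential_ge => //; lra.
have h2 : (1 + v^-1) * (2 - delta * ln (1 + v^-1)) <= potential delta (1 + v^-1).
  by apply: potential_ge => //; lra.
(* With this splitting all terms in [ln v] cancel in the drift, and only multiples of
   [ln (1 + v^-1) <= v^-1] are left to bound. *)
have lE : ln (v + 1) = ln v + ln (1 + v^-1).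
  rewrite -lnM ?posrE//; last by lra.
  by rewrite mulrDr vw mulr1.
have l1 : ln (1 + v^-1) <= v^-1 by apply: le_ln1Dx; lra.
set l := ln (1 + v^-1) in lE l1 h2 *; rewrite lE in h1.
have dl : delta * l <= delta * v^-1 by rewrite ler_pM2l.
have h3 : v * ((v + 1) * (2 - delta * (ln v + l))) <= v * potential delta (v + 1).
  by rewrite ler_pM2l.
set w := v^-1 in w0 w1 vw dl h2 *.
have h4 : (v * (v + 1)) * (delta * l) <= (v + 1) * delta.
  apply: (@le_trans _ _ (v * (v + 1) * (delta * w))).
    by apply: ler_wpM2l => //; nra.
  have -> : v * (v + 1) * (delta * w) = (v * w) * ((v + 1) * delta) by ring.
  by rewrite vw mul1r.
have h5 : (1 + w) * (delta * l) <= delta * (1 + w) * w.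
  have -> : delta * (1 + w) * w = (1 + w) * (delta * w) by ring.
  by apply: ler_wpM2l => //; lra.
have h6 : delta * (1 + w) * w <= 2 * w * delta.
  have : 0 <= delta * w * (1 - w) by rewrite !mulr_ge0//; lra.
  lra.
have h7 : delta * w <= w by rewrite ler_piMl// ltW.
nra.
Qed.

(** * The weight and its mean growth in one step *)

(** The potential enters with a minus sign, scaled by the relative growth (1 + B)^s - 1 of the power
    at a change, so that its mean gain compensates that growth. *)
Definition weight {R : realType} (B s delta M m : R) : R :=
  (M + B * m) `^ s * (1 - ((1 + B) `^ s - 1) * potential delta (M / m)).

Lemma powR_subr1_ge0 (R : realType) (a s : R) : 1 <= a -> 0 <= s -> 0 <= a `^ s - 1.
Proof. by move=> a1 s0; rewrite subr_ge0 -{1}(powRr0 a); apply: (ler_powR a1 s0). Qed.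

Lemma weight_factor (R : realType) (eta delta v : R) : 0 <= eta -> 0 < delta ->
  eta * (delta * cutoff delta) <= 2^-1 -> 0 < v ->
  2^-1 <= 1 - eta * potential delta v <= 1.
Proof.
move=> eta0 d0 small v0; have : eta * potential delta v <= eta * (delta * cutoff delta).
  by rewrite ler_wpM2l// potential_le.
have : 0 <= eta * potential delta v by rewrite mulr_ge0// potential_ge0.
by move=> ? ?; apply/andP; split; lra.
Qed.

Lemma weight_ge (R : realType) (B s delta M m : R) :
  1 <= B -> 0 < s -> 0 < delta ->
  ((1 + B) `^ s - 1) * (delta * cutoff delta) <= 2^-1 ->
  0 < m -> 0 < M -> M `^ s / 2 <= weight B s delta M m.
Proof.
move=> B1 s0 d0 small m0 M0; rewrite /weight.
have eta0 : 0 <= (1 + B) `^ s - 1 by apply: powR_subr1_ge0; lra.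
have /andP[h _] := weight_factor _ _ _ _ eta0 d0 small (divr_gt0 M0 m0).
apply: ler_pM => //; rewrite ?powR_ge0 ?invr_ge0//.
by apply: ge0_ler_powR; rewrite ?nnegrE ?(ltW s0)//; nra.
Qed.

(** A run leads to the pair [(M + m, m)] with probability [M / (M + m)], a change to [(M + m, M)]
    with probability [m / (M + m)]; the mean is multiplied by [M + m] to clear denominators. *)
Lemma weight_step (R : realType) (B s delta M m : R) :
  1 <= B -> 0 < s -> 0 < delta -> delta <= 1 ->
  ((1 + B) `^ s - 1) * (delta * cutoff delta) <= 2^-1 ->
  0 < m -> m <= M ->
  M * weight B s delta (M + m) m + m * weight B s delta (M + m) M <=
  (1 + B^-1) `^ s * (1 + 4 * ((1 + B) `^ s - 1) * delta) *
  ((M + m) * weight B s delta M m).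
Proof.
move=> B1 s0 d0 d1 small m0 mM; rewrite /weight.
have eta0 : 0 <= (1 + B) `^ s - 1 by apply: powR_subr1_ge0; lra.
have fac v := weight_factor _ _ _ v eta0 d0 small.
set eta := (1 + B) `^ s - 1 in eta0 small fac *.
have M0 : 0 < M by apply: lt_le_trans mM.
have v1 : 1 <= M / m by rewrite ler_pdivlMr// mul1r.
have v0 : 0 < M / m by rewrite divr_gt0.
have B0 : 0 < B by lra.
have [mn Mn] : m != 0 /\ M != 0 by rewrite !gt_eqF.
have -> : (M + m) / m = M / m + 1 by rewrite mulrDl divff.
have -> : (M + m) / M = 1 + (M / m)^-1 by rewrite mulrDl divff// invf_div.
set v := M / m in v0 v1 *.
have Mv : M = v * m by rewrite /v mulfVK.
clearbody v.
set P := (M + B * m) `^ s; set alpha := (1 + B^-1) `^ s.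
have P0 : 0 <= P by exact: powR_ge0.
have alpha1 : 1 <= alpha.
  rewrite -(powRr0 (1 + B^-1)); apply: (ler_powR _ (ltW s0)).
  by rewrite lerDl invr_ge0 ltW.
have up : (M + m + B * m) `^ s <= alpha * P.
  rewrite -powRM ?addr_ge0 ?invr_ge0 ?mulr_ge0 ?(ltW B0) ?(ltW M0) ?(ltW m0)//.
  apply: ge0_ler_powR; rewrite ?nnegrE ?(ltW s0)//; [nra|..].
    by rewrite mulr_ge0 ?addr_ge0 ?invr_ge0 ?mulr_ge0 ?(ltW B0) ?(ltW M0) ?(ltW m0).
  have -> : (1 + B^-1) * (M + B * m) = M + m + B * m + B^-1 * M.
    by rewrite mulrDl mul1r mulrDr mulrA mulVf ?gt_eqF// mul1r; ring.
  by rewrite lerDl mulr_ge0 ?invr_ge0 ?(ltW B0) ?(ltW M0).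
have down : (M + m + B * M) `^ s <= (1 + eta) * P.
  rewrite /eta (addrC 1) subrK -powRM; [|nra|nra].
  by apply: ge0_ler_powR; rewrite ?nnegrE ?(ltW s0)//; nra.
have /andP[h1 _] : 2^-1 <= 1 - eta * potential delta (v + 1) <= 1.
  by apply: fac; lra.
have w0 : 0 < v^-1 by rewrite invr_gt0.
have /andP[h2 _] : 2^-1 <= 1 - eta * potential delta (1 + v^-1) <= 1.
  by apply: fac; lra.
have /andP[h3 _] := fac v v0.
have := potential_drift R delta v d0 d1 v1.
have p2 : 0 <= potential delta (1 + v^-1) by apply: potential_ge0 => //; lra.
move: h1 h2 h3 p2.
set p0 := potential delta v; set q1 := potential delta (v + 1).
set q2 := potential delta (1 + v^-1) => h1 h2 h3 p2 drift.
(* The drift inequality times [eta]: its term 1 cancels the extra [eta] of a change, and its 2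
   becomes 4 because [1 - eta * p0] is at least one half. *)
have key : v * (1 - eta * q1) + (1 + eta) * (1 - eta * q2) <=
    (1 + 4 * eta * delta) * ((v + 1) * (1 - eta * p0)).
  have e1 := ler_wpM2l eta0 drift.
  have e2 : 0 <= eta * eta * q2 by rewrite !mulr_ge0.
  have e3 : 0 <= eta * delta * (v + 1) * (1 - eta * p0 - 2^-1).
    by rewrite !mulr_ge0 ?(ltW d0)//; lra.
  lra.
have u1 : M * ((M + m + B * m) `^ s * (1 - eta * q1)) <=
    alpha * P * m * (v * (1 - eta * q1)).
  rewrite Mv in up *.
  have -> : v * m * ((v * m + m + B * m) `^ s * (1 - eta * q1)) =
    (v * m + m + B * m) `^ s * (m * (v * (1 - eta * q1))) by ring.
  rewrite -[leRHS]mulrA; apply: ler_wpM2r => //.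
  by rewrite !mulr_ge0 ?(ltW m0) ?(ltW v0)//; lra.
have u2 : m * ((M + m + B * M) `^ s * (1 - eta * q2)) <=
    alpha * P * m * ((1 + eta) * (1 - eta * q2)).
  rewrite mulrCA; apply: (@le_trans _ _ ((1 + eta) * P * (m * (1 - eta * q2)))).
    by apply: ler_wpM2r => //; rewrite mulr_ge0 ?(ltW m0)//; lra.
  have -> : (1 + eta) * P * (m * (1 - eta * q2)) =
    1 * ((1 + eta) * P * (m * (1 - eta * q2))) by rewrite mul1r.
  have -> : alpha * P * m * ((1 + eta) * (1 - eta * q2)) =
    alpha * ((1 + eta) * P * (m * (1 - eta * q2))) by ring.
  by apply: ler_wpM2r => //; rewrite !mulr_ge0 ?(ltW m0)//; lra.
apply: (le_trans (lerD u1 u2)); rewrite -mulrDr.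
have -> : alpha * (1 + 4 * eta * delta) * ((M + m) * (P * (1 - eta * p0))) =
  alpha * P * m * ((1 + 4 * eta * delta) * ((v + 1) * (1 - eta * p0))).
  by rewrite Mv; ring.
by apply: ler_wpM2l => //; rewrite !mulr_ge0 ?(ltW m0)//; lra.
Qed.

(** * Choice of the parameters of the weight *)

Lemma expR_le1D2x (R : realType) (x : R) : 0 <= x <= 2^-1 -> expR x <= 1 + 2 * x.
Proof.
move=> /andP[x0 x1]; have := @expR_ge1Dx R (- x); rewrite expRN => h.
have e0 := @expR_gt0 R x.
have : (1 - x) * expR x <= 1 by rewrite -ler_pdivlMr// div1r.
nra.
Qed.

Lemma powR_expR (R : realType) (x y : R) : 0 < x -> x `^ y = expR (y * ln x).
Proof. by move=> x0; rewrite /powR gt_eqF. Qed.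

(** Since 1/(cd) is the length of the interval attached to the row (c, d), the last clause bounds
    the integral of the weight after one turn. The parameters are chosen in the order [B], [delta],
    [s]. *)
Lemma exists_weight (R : realType) (eps : R) : 0 < eps ->
  exists (s : R) (G : R -> R -> R), [/\ 0 < s,
    forall c d : R, 0 < c -> 0 < d -> Num.max c d `^ s / 2 <= G c d &
    forall c d : R, 0 < c -> 0 < d ->
      G (c + d) d / ((c + d) * d) + G c (c + d) / (c * (c + d)) <=
      expR (s * eps) * (G c d / (c * d))].
Proof.
move=> e0.
(* Runs then cost at most half of the exponent, as ln (1 + 1/B) <= 1/B <= [eps / 2]. *)
pose B : R := 1 + 2 / eps.
have B1 : 1 <= B by rewrite lerDl divr_ge0// ltW.
have Bi : B^-1 <= eps / 2.
  rewrite -[leRHS]invrK lef_pV2 ?posrE ?invr_gt0 ?divr_gt0//; last by lra.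
  by rewrite invf_div lerDr.
pose l := ln (1 + B).
have l0 : 0 < l by rewrite ln_gt0//; lra.
(* The other half of the exponent: [4 * eta * delta <= 8 * s * l * delta <= s * eps / 2]. *)
pose delta := Num.min 1 (eps / (16 * l)).
have d0 : 0 < delta by rewrite lt_min ltr01 divr_gt0// mulr_gt0.
have d1 : delta <= 1 by rewrite ge_min lexx.
have dl : 16 * l * delta <= eps.
  by rewrite -ler_pdivlMl ?mulr_gt0// mulrC ge_min lexx orbT.
pose S := delta * cutoff delta.
have S0 : 0 <= S by rewrite mulr_ge0 ?(ltW d0)// ltW// cutoff_gt0.
(* Small enough for both [s * l <= 1/2], which makes [eta] at most [2 * (s * l)], and
   [eta * S <= 1/2]. *)
pose s := (2 * l * (1 + 2 * S))^-1.
have s0 : 0 < s by rewrite invr_gt0 !mulr_gt0//; lra.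
have sl : s * l * (2 * (1 + 2 * S)) = 1.
  rewrite -[RHS](@mulVf _ (2 * l * (1 + 2 * S))) ?gt_eqF ?mulr_gt0//; last by lra.
  by rewrite /s; ring.
have sl0 : 0 < s * l by rewrite mulr_gt0.
pose eta := (1 + B) `^ s - 1.
have eta_le : eta <= 2 * (s * l).
  rewrite /eta powR_expR; last by lra.
  rewrite lerBlDl; apply: expR_le1D2x; rewrite -/l; apply/andP; split; nra.
have eta0 : 0 <= eta.
  by apply: powR_subr1_ge0; lra.
have small : eta * S <= 2^-1.
  apply: (@le_trans _ _ (2 * (s * l) * S)); first exact: ler_wpM2r.
  lra.
exists s, (fun c d => weight B s delta (Num.max c d) (Num.min c d)); split => //.
  by move=> c d c0 d0'; apply: weight_ge => //; rewrite ?lt_min ?lt_max c0// d0'.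
have kap : (1 + B^-1) `^ s * (1 + 4 * eta * delta) <= expR (s * eps).
  apply: (@le_trans _ _ (expR (s * eps / 2) * expR (s * eps / 2))); last first.
    by rewrite -expRD ler_expR; lra.
  have B0 : 0 < B^-1 by rewrite invr_gt0; lra.
  apply: ler_pM; rewrite ?powR_ge0 ?addr_ge0 ?mulr_ge0 ?(ltW d0)//.
    rewrite powR_expR; last by lra.
    rewrite ler_expR -mulrA ler_pM2l//.
    by apply: le_trans Bi; apply: le_ln1Dx; lra.
  apply: (@le_trans _ _ (expR (4 * eta * delta))); first exact: expR_ge1Dx.
  rewrite ler_expR.
  have : eta * delta <= 2 * (s * l) * delta by rewrite ler_pM2r.
  have : s * (16 * l * delta) <= s * eps by rewrite ler_pM2l.
  lra.
(* The one-step bound divided by [M * m * (M + m)], which turns probabilities back into interval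
   lengths. *)
have step M m : 0 < m -> m <= M ->
    weight B s delta (M + m) m / ((M + m) * m) + weight B s delta (M + m) M / (M * (M + m)) <=
    expR (s * eps) * (weight B s delta M m / (M * m)).
  move=> m0 mM; have M0 : 0 < M by apply: lt_le_trans mM.
  have Mm0 : 0 < M + m by lra.
  have := weight_step _ B s delta M m B1 s0 d0 d1 small m0 mM.
  have : 0 <= (M + m) * weight B s delta M m.
    have := weight_ge _ B s delta M m B1 s0 d0 small m0 M0.
    by have := powR_ge0 M s; rewrite pmulr_rge0//; lra.
  move=> /(ler_wpM2r)/(_ _ _ kap) k1 k2.
  have := le_trans k2 k1.
  have q0 : 0 < (M * m * (M + m))^-1 by rewrite invr_gt0 !mulr_gt0.
  rewrite -(ler_pM2r q0); congr (_ <= _); field; rewrite ?gt_eqF//.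
move=> c d c0 d0'.
have mx1 : Num.max (c + d) d = c + d by rewrite max_l// lerDr ltW.
have mn1 : Num.min (c + d) d = d by rewrite min_r// lerDr ltW.
have mx2 : Num.max c (c + d) = c + d by rewrite max_r// lerDl ltW.
have mn2 : Num.min c (c + d) = c by rewrite min_l// lerDl ltW.
rewrite mx1 mn1 mx2 mn2.
have [cd|/ltW dc] := leP c d.
- have := step d c c0 cd.
  by rewrite addrC (addrC d) (mulrC c (c + d)) (mulrC d (c + d)) (mulrC d c).
- exact: step c d d0' dc.
Qed.

(** * Farey matrices and the intervals attached to them *)

Lemma mulmx_turnE (A : 'M[nat]_2) (i : 'I_2) :
  ((A *m turn_mx TurnR) i ord0 = (A i ord0 + A i ord_max)%N) *
  ((A *m turn_mx TurnR) i ord_max = A i ord_max) *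
  ((A *m turn_mx TurnL) i ord0 = A i ord0) *
  ((A *m turn_mx TurnL) i ord_max = (A i ord0 + A i ord_max)%N).
Proof.
have o (k : 'I_1) : lift ord0 k = ord_max :> 'I_2 by apply/val_inj; rewrite /= ord1.
by rewrite !mxE !big_ord_recl !big_ord0 !mxE /= !o /= !mulr1 !mulr0 !addr0 ?add0r.
Qed.

Definition farey_left {R : realType} (A : 'M[nat]_2) : R :=
  (A ord0 ord_max)%:R / (A ord_max ord_max)%:R.

Definition farey_right {R : realType} (A : 'M[nat]_2) : R :=
  (A ord0 ord0)%:R / (A ord_max ord0)%:R.

(** The invariant of paths in (0, 1) after the first turn; the identity fails it, having a zero in
    its bottom row. Determinant 1 is written without subtraction, and the last two clauses put the
    largest entry in the bottom row. *)
Definition farey_mx (A : 'M[nat]_2) : Prop :=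
  [/\ (0 < A ord_max ord0)%N, (0 < A ord_max ord_max)%N,
      (A ord0 ord0 * A ord_max ord_max = A ord0 ord_max * A ord_max ord0 + 1)%N,
      (A ord0 ord0 <= A ord_max ord0)%N & (A ord0 ord_max <= A ord_max ord_max)%N].

Lemma farey_mx_turn (A : 'M[nat]_2) (t : turn) : farey_mx A -> farey_mx (A *m turn_mx t).
Proof. by case: t => -[? ? ? ? ?]; split; rewrite !mulmx_turnE; nia. Qed.

Lemma farey_mx_turnR : farey_mx (turn_mx TurnR).
Proof. by split; rewrite !mxE. Qed.

Lemma farey_length (R : realType) (A : 'M[nat]_2) : farey_mx A ->
  farey_right A - farey_left A = ((A ord_max ord0)%:R * (A ord_max ord_max)%:R)^-1 :> R.
Proof.
case; rewrite /farey_right /farey_left.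
move: (A ord0 ord0) (A ord0 ord_max) (A ord_max ord0) (A ord_max ord_max) => a b c d.
move=> c0 d0 /(congr1 (fun n => n%:R : R)); rewrite natrD !natrM => E _ _.
have [c0' d0'] : (c%:R != 0 :> R) /\ (d%:R != 0 :> R) by rewrite !pnatr_eq0 -!lt0n.
apply: (mulIf c0'); apply: (mulIf d0').
rewrite mulrBl mulrBl invfM.
have -> : a%:R / c%:R * c%:R * d%:R = a%:R * d%:R :> R by rewrite mulfVK.
have -> : b%:R / d%:R * c%:R * d%:R = b%:R * c%:R :> R by rewrite mulrAC mulfVK.
have -> : c%:R^-1 / d%:R * c%:R * d%:R = 1 :> R by rewrite mulrAC mulfVK// mulVf.
by rewrite E addrC addKr.
Qed.

(* Contains every x, never equal to a mediant, whose path after n more steps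
   from A has a bottom row of weight at least Y. *)
Fixpoint farey_cover {R : realType} (G : R -> R -> R) (Y : R) (n : nat) (A : 'M[nat]_2) : set R :=
  if n is m.+1 then
    farey_cover G Y m (A *m turn_mx TurnR) `|` farey_cover G Y m (A *m turn_mx TurnL)
  else if Y <= G (A ord_max ord0)%:R (A ord_max ord_max)%:R
       then `]farey_left A, farey_right A[%classic else set0.

Lemma measurable_farey_cover (R : realType) (G : R -> R -> R) (Y : R) n A :
  measurable (farey_cover G Y n A).
Proof.
elim: n A => [|n IHn] A /=; last exact: measurableU.
by case: ifP => _; [exact: measurable_itv|exact: measurable0].
Qed.

(** Markov's inequality, by induction with the first turn split off. At depth 0 the interval has
    length 1/(cd), at most G/(cdY) when G reaches [Y]; each turn costs a factor [kappa]. *)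
Lemma farey_cover_le (R : realType) (G : R -> R -> R) (kappa Y : R) n A :
  (forall c d : R, 0 < c -> 0 < d -> 0 <= G c d) ->
  (forall c d : R, 0 < c -> 0 < d ->
    G (c + d) d / ((c + d) * d) + G c (c + d) / (c * (c + d)) <=
    kappa * (G c d / (c * d))) ->
  0 <= kappa -> 0 < Y -> farey_mx A ->
  (@lebesgue_measure R (farey_cover G Y n A) <=
   (kappa ^+ n * (G (A ord_max ord0)%:R (A ord_max ord_max)%:R /
      ((A ord_max ord0)%:R * (A ord_max ord_max)%:R)) / Y)%:E)%E.
Proof.
move=> G0 step k0 Y0; elim: n A => [|n IHn] A FA.
  have [c0 d0 _ _ _] := FA.
  have c0' : 0 < (A ord_max ord0)%:R :> R by rewrite ltr0n.
  have d0' : 0 < (A ord_max ord_max)%:R :> R by rewrite ltr0n.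
  rewrite expr0 mul1r /=; case: ifP => [YG|_]; last first.
    by rewrite measure0 lee_fin !mulr_ge0 ?invr_ge0 ?mulr_ge0 ?(ltW c0') ?(ltW d0') ?(ltW Y0)// G0.
  rewrite lebesgue_measure_itv /= lte_fin; case: ifP => _; last first.
    by rewrite lee_fin !mulr_ge0 ?invr_ge0 ?mulr_ge0 ?(ltW c0') ?(ltW d0') ?(ltW Y0)// G0.
  rewrite -EFinB lee_fin farey_length// ler_pdivlMr// mulrC ler_pM2r//.
  by rewrite invr_gt0 mulr_gt0.
rewrite [farey_cover _ _ _ _]/=.
apply: (le_trans (measureU2 _ _ _)); try exact: measurable_farey_cover.
apply: (le_trans (leeD (IHn _ (farey_mx_turn _ TurnR FA)) (IHn _ (farey_mx_turn _ TurnL FA)))).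
rewrite -EFinD lee_fin -mulrDl ler_pM2r ?invr_gt0// -mulrDr exprSr -mulrA.
rewrite ler_wpM2l ?exprn_ge0// !mulmx_turnE !natrD.
by case: FA => c0 d0 _ _ _; apply: step; rewrite ltr0n.
Qed.

(** * Paths of points that never equal a mediant *)

(** A countable, hence null, set containing 0, 1 and all mediants. Off it equality never occurs, so
    both choices of [e] give the same path. *)
Definition nat_fractions (R : realType) : set R :=
  range (fun p : nat * nat => p.1%:R / p.2%:R).

Lemma countable_nat_fractions (R : realType) : countable (nat_fractions R).
Proof. exact: card_le_trans (card_image_le _ _) (countableP _). Qed.

Lemma mediant_nat_fraction (R : realType) (A : 'M[nat]_2) : nat_fractions R (mediant R A).
Proof. by exists ((A ord0 ord0 + A ord0 ord_max)%N, (A ord_max ord0 + A ord_max ord_max)%N). Qed.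

Lemma farey_turnE (R : realType) (A : 'M[nat]_2) :
  (farey_left (A *m turn_mx TurnR) = farey_left A :> R) *
  (farey_right (A *m turn_mx TurnR) = mediant R A) *
  (farey_left (A *m turn_mx TurnL) = mediant R A) *
  (farey_right (A *m turn_mx TurnL) = farey_right A :> R).
Proof. by rewrite /farey_left /farey_right /mediant !mulmx_turnE. Qed.

(** The mediant cuts the interval of [A] in two, and the turn selects the piece containing [x]; the
    state stays [None] because [x] is never the mediant. *)
Lemma iter_farey_step (R : realType) (G : R -> R -> R) (Y : R) (e : turn) (x : R) n A :
  ~ nat_fractions R x -> farey_mx A -> farey_left A < x < farey_right A ->
  exists A', [/\ iter n (farey_step e x) (A, None) = (A', None), farey_mx A' &
    Y <= G (A' ord_max ord0)%:R (A' ord_max ord_max)%:R -> farey_cover G Y n A x].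
Proof.
move=> xQ; elim: n A => [|n IHn] A FA /andP[lx xr].
  by exists A; split => // YG /=; rewrite YG /= in_itv /= lx.
have [xm|mx|xE] := ltgtP x (mediant R A).
- have [||A' [E FA' H]] := IHn (A *m turn_mx TurnR); first exact: farey_mx_turn.
    by rewrite !farey_turnE lx.
  exists A'; split => //; last by move=> /H; left.
  by rewrite iterSr /= xm.
- have [||A' [E FA' H]] := IHn (A *m turn_mx TurnL); first exact: farey_mx_turn.
    by rewrite !farey_turnE mx.
  exists A'; split => //; last by move=> /H; right.
  by rewrite iterSr /= ltNge (ltW mx) /= mx.
- by case: xQ; rewrite xE; exact: mediant_nat_fraction.
Qed.

(** The first mediant is 1, so the first turn is R; the cover starts from that matrix, hence the
    shift between [n.+1] and [n]. *)
Lemma farey_pathS (R : realType) (G : R -> R -> R) (Y : R) (e : turn) (x : R) n :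
  ~ nat_fractions R x -> 0 <= x <= 1 ->
  farey_mx (farey_path e x n.+1) /\
  (Y <= G (farey_path e x n.+1 ord_max ord0)%:R (farey_path e x n.+1 ord_max ord_max)%:R ->
   farey_cover G Y n (turn_mx TurnR) x).
Proof.
move=> xQ /andP[x0 x1].
have {}x0 : 0 < x.
  by rewrite lt_def x0 andbT; apply: contra_notN xQ => /eqP ->; exists (0, 0)%N; rewrite //= mul0r.
have {}x1 : x < 1.
  rewrite lt_def x1 andbT; apply: contra_notN xQ => /eqP <-.
  by exists (1, 1)%N; rewrite //= divr1.
have m1 : mediant R 1%:M = 1 by rewrite /mediant !mxE /= divr1.
have -> : farey_path e x n.+1 = (iter n (farey_step e x) (turn_mx TurnR, None)).1.
  by rewrite /farey_path iterSr /= m1 x1 mul1mx.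
have [|A' [-> FA' H]] := iter_farey_step _ G Y e x n _ xQ farey_mx_turnR.
  by rewrite /farey_left /farey_right !mxE /= mul0r x0 divr1.
by split.
Qed.

Lemma largest_entry_farey (A : 'M[nat]_2) : farey_mx A ->
  (0 < largest_entry A <= maxn (A ord_max ord0) (A ord_max ord_max))%N.
Proof.
move=> [c0 d0 _ ac bd].
have -> : largest_entry A = maxn (maxn (A ord0 ord0) (A ord0 ord_max))
    (maxn (A ord_max ord0) (A ord_max ord_max)).
  have o (k : 'I_1) : lift ord0 k = ord_max :> 'I_2 by apply/val_inj; rewrite /= ord1.
  by rewrite /largest_entry !big_ord_recl !big_ord0 !o !maxn0.
lia.
Qed.

(** * Almost sure growth by Borel-Cantelli, then the limit *)

Lemma largest_entry_growth (R : realType) (eps : R) : 0 < eps ->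
  {ae @lebesgue_measure R, forall x : R, 0 <= x <= 1 -> forall e : turn,
     \forall n \near \oo, (0 < largest_entry (farey_path e x n))%N /\
       (largest_entry (farey_path e x n))%:R <= expR (eps * n%:R)}.
Proof.
move=> eps0; have he : 0 < eps / 2 by rewrite divr_gt0.
have [s [G [s0 Gge step]]] := exists_weight R (eps / 2) he.
have G0 (c d : R) : 0 < c -> 0 < d -> 0 <= G c d.
  by move=> c0 d0; apply: le_trans (Gge c d c0 d0); rewrite divr_ge0 ?powR_ge0.
(* The division by 2 matches the lower bound [Gge], so that a weight below [Y n] forces the maximum
   below [expR (eps * n%:R)]. *)
pose Y n := expR (s * eps * n%:R) / 2.
pose E n := farey_cover G (Y n) n (turn_mx TurnR).
have mE n : measurable (E n) by exact: measurable_farey_cover.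
(* The mean weight grows at half the exponential rate of [Y], which leaves this ratio. The factor
   [2 * G 1 1] below comes from the starting bottom row (1, 1) and the 2 in [Y]. *)
pose z := expR (- (s * (eps / 2))).
have muE n : (@lebesgue_measure R (E n) <= (geometric (2 * G 1 1) z n)%:E)%E.
  have := farey_cover_le R G (expR (s * (eps / 2))) (Y n) n (turn_mx TurnR) G0 step
    (expR_ge0 _) (divr_gt0 (expR_gt0 _) (ltr0Sn _ 1)) farey_mx_turnR.
  move=> /le_trans; apply; rewrite lee_fin !mxE /= mulr1 divr1 /Y -expRM_natr.
  rewrite /z -expRM_natr invf_div.
  have -> : - (s * (eps / 2)) * n%:R = s * (eps / 2) * n%:R - s * eps * n%:R by field.
  by rewrite expRB le_eqVlt; apply/orP; left; apply/eqP; ring.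
have sumE : (\sum_(n <oo) @lebesgue_measure R (E n) < +oo)%E.
  have z1 : `|z| < 1 by rewrite ger0_norm ?expR_ge0// expR_lt1 oppr_lt0 mulr_gt0.
  apply: (@le_lt_trans _ _ (\sum_(n <oo) (geometric (2 * G 1 1) z n)%:E)%E).
    exact: lee_nneseries.
  apply: (@le_lt_trans _ _ ((2 * G 1 1) * (1 - z)^-1)%:E); last exact: ltry.
  apply: lime_le.
    apply: is_cvg_nneseries => n _ _.
    by rewrite lee_fin mulr_ge0 ?exprn_ge0 ?expR_ge0// mulr_ge0// G0.
  apply: nearW => n; rewrite sumEFin lee_fin.
  by apply: geometric_le_lim; rewrite ?expR_gt0// mulr_ge0// G0.
(* Borel-Cantelli: almost every point lies in only finitely many [E n]. *)
have N0 : @lebesgue_measure R (lim_sup_set E) = 0%E by exact: lim_sup_set_cvg0.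
have mL : measurable (lim_sup_set E).
  by apply: bigcap_measurable => // k _; exact: bigcup_measurable.
have negl : (@lebesgue_measure R).-negligible (lim_sup_set E `|` nat_fractions R).
  apply: negligibleU; first by apply/negligibleP.
  have mQ : measurable (nat_fractions R) by exact: (countable_measurable (@measurable_set1 R) (countable_nat_fractions R)).
  by apply/negligibleP => //; exact/countable_lebesgue_measure0/countable_nat_fractions.
apply: negligibleS negl => x /= nx; apply: contrapT => /not_orP[xE xQ].
apply: nx => x01 e.
have [N HN] : exists N, forall n, (N <= n)%N -> ~ E n x.
  apply: contrapT => H; apply: xE => N _ /=.
  apply: contrapT => H'; apply: H; exists N => n Nn En; apply: H'.
  by exists n.
near=> n.
have n0 : (0 < n)%N by near: n; exists 1%N.
have Nn : (N <= n.-1)%N by near: n; exists N.+1 => // n /=; lia.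
have [FA H] := farey_pathS R G (Y n.-1) e x n.-1 xQ x01.
rewrite prednK// in FA H.
have /andP[w0 wle] := largest_entry_farey _ FA.
split => //.
have [c0 d0 _ _ _] := FA.
move: (farey_path e x n) FA H w0 wle c0 d0 => A FA H w0 wle c0 d0.
set c := A ord_max ord0 in H wle c0; set d := A ord_max ord_max in H wle d0.
have c0' : 0 < c%:R :> R by rewrite ltr0n.
have d0' : 0 < d%:R :> R by rewrite ltr0n.
have GY : G c%:R d%:R < Y n.-1 by rewrite ltNge; apply/negP => /H; exact: HN.
have := le_lt_trans (Gge _ _ c0' d0') GY.
have -> : Num.max c%:R d%:R = (maxn c d)%:R :> R by rewrite natr_max.
rewrite /Y ltr_pM2r ?invr_gt0// => pw.
have mx0 : 0 < (maxn c d)%:R :> R by rewrite ltr0n; lia.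
(* Taking logarithms and dividing by [s] removes the power. *)
have : (maxn c d)%:R <= expR (eps * n.-1%:R).
  rewrite powR_expR// ltr_expR -mulrA ltr_pM2l// in pw.
  by rewrite -[leLHS]lnK ?posrE// ler_expR ltW.
move=> h; apply: (@le_trans _ _ (maxn c d)%:R); first by rewrite ler_nat.
apply: le_trans h _; rewrite ler_expR ler_pM2l// ler_nat leq_pred.
Unshelve. all: by end_near.
Qed.

(** The rates 1/(k+1) suffice, so the exceptional set is a countable union of null sets. An entry at
    least 1 has nonnegative logarithm, which gives the lower bound. *)
Lemma lyapunov_seq_cvg0 (R : realType) :
  {ae @lebesgue_measure R, forall x : R, 0 <= x <= 1 ->
     forall e : turn, lyapunov_seq e x @ \oo --> (0 : R)}.
Proof.
pose P k (x : R) := 0 <= x <= 1 -> forall e : turn,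
  \forall n \near \oo, (0 < largest_entry (farey_path e x n))%N /\
    (largest_entry (farey_path e x n))%:R <= expR (k.+1%:R^-1 * n%:R) :> R.
have aeP k : {ae @lebesgue_measure R, forall x, P k x}.
  by apply: largest_entry_growth; rewrite invr_gt0.
have := ae_foralln aeP.
apply: filterS => x H x01 e.
apply/cvgrPdist_le => eps eps0.
have [k ke] : exists k : nat, k.+1%:R^-1 <= eps.
  exists (Num.truncn eps^-1); rewrite invf_ple ?posrE//.
  by rewrite ltW// truncnS_gt.
near=> n.
have n0 : 0 < n%:R :> R by rewrite ltr0n; near: n; exists 1%N.
have [w0 wn] : (0 < largest_entry (farey_path e x n))%N /\
    (largest_entry (farey_path e x n))%:R <= expR (k.+1%:R^-1 * n%:R) :> R.
  by near: n; exact: H.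
rewrite sub0r normrN /lyapunov_seq ger0_norm; last first.
  by rewrite divr_ge0 ?(ltW n0)// ln_ge0// ler1n.
rewrite ler_pdivrMr//; apply: (@le_trans _ _ (k.+1%:R^-1 * n%:R)).
  by rewrite -[leRHS]expRK ler_ln ?posrE ?expR_gt0// ltr0n.
by rewrite ler_pM2r.
Unshelve. all: by end_near.
Qed.

Theorem theorem4 (R : realType) :
  {ae @lebesgue_measure R, forall x : R, 0 <= x <= 1 ->
     forall e : turn, Lyapunov e x = 0%E} /\
  {ae @lebesgue_measure R, forall x : R, 0 <= x <= 1 ->
     forall e : turn, (EFin \o lyapunov_seq e x) @ \oo --> Lyapunov e x}.
Proof.
have cE (x : R) e : lyapunov_seq e x @ \oo --> (0 : R) ->
    (EFin \o lyapunov_seq e x) @ \oo --> 0%E.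
  by move=> c; apply: cvg_EFin => //; exact: nearW.
(* A limsup of a convergent sequence is its limit, so both claims hold off the same null set. *)
have L0 (x : R) e : lyapunov_seq e x @ \oo --> (0 : R) -> Lyapunov e x = 0%E.
  move=> /cE c.
  by rewrite /Lyapunov (is_cvg_limn_esupE (cvgP _ c)); exact: cvg_lim.
have ae0 := lyapunov_seq_cvg0 R.
split; apply: negligibleS ae0 => x; apply: contra_not => H x01 e; first exact/L0/H.
by rewrite L0; [exact/cE/H|exact: H].
Qed.
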